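(* Let $(M,g)$ be a finite-dimensional Riemannian manifold with Levi-Civita connection $\nabla$ and let $J$ be a tensor field of type $(1,1)$ on $M$. If $J$ is $g$-selfadjoint, i.e. $g(JX,Y)=g(X,JY)$ for all $X,Y\in\mathcal{X}(M)$, and $$(\nabla_XJ)Y=(\nabla_YJ)X\qquad\text{for every }X,Y\in\mathcal{X}(M),$$ then $(M,g,A)$ with $A(X,Y)=(\nabla_XJ)Y$ is a formal Frobenius structure.
   Context: $\mathcal{X}(M)$ denotes the smooth vector fields on $M$. For a Riemannian metric $g$ on $M$ and a tensor field $A$ of type $(1,2)$, the triple $(M,g,A)$ is called a formal Frobenius structure if (i) $g(A(X,Y),Z)=g(X,A(Y,Z))$ for all $X,Y,Z\in\mathcal{X}(M)$, and (ii) $A(X,Y)=A(Y,X)$ for all $X,Y\in\mathcal{X}(M)$. *)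

(* Defs.v *)
From HB Require Import structures.
From mathcomp Require Import all_boot all_order all_algebra.
From mathcomp Require Import all_classical all_reals all_analysis.
From mathcomp Require Import ring.

Set Implicit Arguments.
Unset Strict Implicit.
Unset Printing Implicit Defensive.

Import Order.TTheory GRing.Theory Num.Theory.
Import numFieldNormedType.Exports.

Local Open Scope classical_set_scope.
Local Open Scope ring_scope.

Section smooth_on.
Variables (R : realType) (n : nat).
Implicit Types (U : set 'rV[R]_n) (f g : 'rV[R]_n -> R).

(* [Cr_on r U f] is meant for open sets [U]: [f] has continuous iterated
   partial derivatives of all orders up to [r] at every point of [U]. *)
Fixpoint Cr_on (r : nat) U f : Prop :=
  (forall x, U x -> {for x, continuous f}) /\
  if r is s.+1 then
    forall i : 'I_n, (forall x, U x -> derivable f x (delta_mx 0 i)) /\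
                     Cr_on s U ('D_(delta_mx 0 i) f)
  else True.

Definition smooth_on U f : Prop := forall r, Cr_on r U f.

Lemma eq_Cr_on r U f g :
  open U -> (forall x, U x -> f x = g x) -> Cr_on r U f -> Cr_on r U g.
Proof.
move=> oU; have near_fg f' g' : (forall x, U x -> f' x = g' x) ->
    forall x, U x -> \near x, f' x = g' x.
  move=> fg x Ux; have : nbhs x U by exact: open_nbhs_nbhs.
  by apply: filterS => y Uy; exact: fg.
have cts f' g' : (forall x, U x -> f' x = g' x) ->
    (forall x, U x -> {for x, continuous f'}) ->
    forall x, U x -> {for x, continuous g'}.
  move=> fg fc x Ux; have := fc x Ux.
  rewrite /prop_for /continuous_at (fg _ Ux); apply: cvg_trans.
  by apply: (@near_eq_cvg _ _ (nbhs x)); exact: near_fg.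
elim: r f g => [|r IH] f g fg /= [fc fd]; split=> //; try exact: cts fc.
move=> i; have [fdi fri] := fd i; split=> [x Ux|].
  by apply: near_eq_derivable (fdi x Ux); exact: near_fg.
by apply: IH fri => x Ux; apply: near_eq_derive; exact: near_fg.
Qed.

Lemma Cr_on_cst r U (a : R) : open U -> Cr_on r U (cst a).
Proof.
move=> oU; elim: r a => [|r IH] a /=; first by split=> // x _; exact: cst_continuous.
split=> [x _|i]; first exact: cst_continuous.
split=> [x _|]; first exact: derivable_cst.
by apply: eq_Cr_on (IH 0) => // x _; rewrite derive_cst.
Qed.

Lemma Cr_onD r U f g : open U ->
  Cr_on r U f -> Cr_on r U g -> Cr_on r U (f + g).
Proof.
move=> oU; elim: r f g => [|r IH] f g /= [fc fd] [gc gd]; split=> //.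
- by move=> x Ux; apply: continuousD; [exact: fc|exact: gc].
- by move=> x Ux; apply: continuousD; [exact: fc|exact: gc].
move=> i; have [fdi fri] := fd i; have [gdi gri] := gd i; split=> [x Ux|].
  by apply: derivableD; [exact: fdi|exact: gdi].
apply: eq_Cr_on (IH _ _ fri gri) => // x Ux.
by rewrite deriveD//; [exact: fdi|exact: gdi].
Qed.

Lemma Cr_onW r U f : Cr_on r.+1 U f -> Cr_on r U f.
Proof.
elim: r f => [|r IH] f /= [fc fd]; first by split.
by split=> // i; have [fdi fri] := fd i; split=> //; exact: IH.
Qed.

Lemma Cr_onM r U f g : open U ->
  Cr_on r U f -> Cr_on r U g -> Cr_on r U (f * g).
Proof.
move=> oU; elim: r f g => [|r IH] f g f_r g_r; have [fc fd] := f_r;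
  have [gc gd] := g_r; split=> //.
- by move=> x Ux; apply: continuousM; [exact: fc|exact: gc].
- by move=> x Ux; apply: continuousM; [exact: fc|exact: gc].
move=> i; have [fdi fri] := fd i; have [gdi gri] := gd i; split=> [x Ux|].
  by apply: derivableM; [exact: fdi|exact: gdi].
have := Cr_onD oU (IH _ _ (Cr_onW f_r) gri) (IH _ _ (Cr_onW g_r) fri).
apply: eq_Cr_on => // x Ux.
by rewrite deriveM//; [exact: fdi|exact: gdi].
Qed.

End smooth_on.

(* A homeomorphism from an open set of [M] onto an open set of [R^n].  The total
   functions [chart_map] and [chart_inv] are only meaningful on [chart_dom] and
   on its image. *)
Record chart (R : realType) (n : nat) (M : topologicalType) := Chart {
  chart_dom : set M;
  chart_map : M -> 'rV[R]_n;
  chart_inv : 'rV[R]_n -> M;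
  chart_dom_open : open chart_dom;
  chart_im_open : open (chart_map @` chart_dom);
  chart_mapK : forall p, chart_dom p -> chart_inv (chart_map p) = p;
  chart_map_continuous :
    forall p, chart_dom p -> {for p, continuous chart_map};
  chart_inv_continuous :
    forall x, (chart_map @` chart_dom) x -> {for x, continuous chart_inv} }.

Definition chart_im (R : realType) (n : nat) (M : topologicalType)
  (c : chart R n M) : set 'rV[R]_n := chart_map c @` chart_dom c.

Definition transition_smooth (R : realType) (n : nat) (M : topologicalType)
    (c d : chart R n M) : Prop :=
  forall i : 'I_n,
    smooth_on (chart_map c @` (chart_dom c `&` chart_dom d))
              (fun x => chart_map d (chart_inv c x) 0 i).

(* The smooth structure is the one generated by [atlas], which need not be
   maximal. *)
Record smoothManifold (R : realType) (n : nat) := SmoothManifold {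
  mfd_space :> topologicalType;
  mfd_hausdorff : hausdorff_space mfd_space;
  mfd_second_countable : @second_countable mfd_space;
  atlas : set (chart R n mfd_space);
  atlas_cover : forall p, exists2 c, atlas c & chart_dom c p;
  atlas_compatible : forall c d, atlas c -> atlas d -> transition_smooth c d }.

Section smooth_functions.
Variables (R : realType) (n : nat) (M : smoothManifold R n).

Definition smooth (f : M -> R) : Prop :=
  forall c, atlas c -> smooth_on (chart_im c) (f \o chart_inv c).

Definition smooth_pred : {pred M -> R} := fun f => `[< smooth f >].

Record smoothFun := SmoothFun {
  smoothFun_val :> M -> R;
  smoothFun_subproof : smoothFun_val \in smooth_pred }.

HB.instance Definition _ := [isSub for smoothFun_val].
HB.instance Definition _ := [Choice of smoothFun by <:].

Lemma smoothP (f : M -> R) : reflect (smooth f) (f \in smooth_pred).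
Proof. exact: asboolP. Qed.

Lemma smooth_cst (a : R) : smooth (cst a).
Proof. by move=> c _ r; apply: Cr_on_cst; exact: chart_im_open. Qed.

Lemma smoothD (f g : M -> R) : smooth f -> smooth g -> smooth (f + g).
Proof.
by move=> fs gs c cA r; apply: Cr_onD; [exact: chart_im_open|exact: fs|exact: gs].
Qed.

Lemma smoothM (f g : M -> R) : smooth f -> smooth g -> smooth (f * g).
Proof.
by move=> fs gs c cA r; apply: Cr_onM; [exact: chart_im_open|exact: fs|exact: gs].
Qed.

Lemma smoothN (f : M -> R) : smooth f -> smooth (- f).
Proof.
move=> fs; rewrite -mulN1r; apply: smoothM => //.
by have -> : (- 1 : M -> R) = cst (- 1) by []; exact: smooth_cst.
Qed.

Lemma smooth_subring_closed : subring_closed smooth_pred.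
Proof.
split=> [|f g /smoothP fs /smoothP gs|f g /smoothP fs /smoothP gs]; apply/smoothP.
- exact: smooth_cst.
- by apply: smoothD => //; exact: smoothN.
- exact: smoothM.
Qed.

HB.instance Definition _ :=
  GRing.SubChoice_isSubComPzRing.Build _ _ smoothFun smooth_subring_closed.

Definition smooth_const (a : R) : smoothFun :=
  SmoothFun (introT (smoothP _) (smooth_cst a)).

Lemma smoothFun_inj (f g : smoothFun) : (forall p, f p = g p) -> f = g.
Proof. by move=> fg; apply: val_inj; apply: funext. Qed.

End smooth_functions.

Section vector_fields.
Variables (R : realType) (n : nat) (M : smoothManifold R n).
Local Notation Coo := (smoothFun M).

(* Tangent vectors at [p] are the [R]-linear derivations at [p] of the algebra of
   smooth functions; multiplication by the real number [a] is multiplication by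
   the constant function [a]. *)
Definition tangent (p : M) (v : Coo -> R) : Prop :=
  [/\ forall f g : Coo, v (f + g) = v f + v g,
      forall (a : R) (f : Coo), v (smooth_const M a * f) = a * v f &
      forall f g : Coo, v (f * g) = v f * g p + f p * v g].

(* A section [p |-> X p] of the tangent bundle is smooth when [p |-> X p f] is
   smooth for every smooth function [f]. *)
Definition vf_pred : {pred M -> Coo -> R} := fun X =>
  `[< (forall p, tangent p (X p)) /\ (forall f, smooth (fun p => X p f)) >].

Record vectorField := VectorField {
  vf_at :> M -> Coo -> R;
  vf_subproof : vf_at \in vf_pred }.

HB.instance Definition _ := [isSub for vf_at].
HB.instance Definition _ := [Choice of vectorField by <:].

Lemma vfP (X : M -> Coo -> R) :
  reflect ((forall p, tangent p (X p)) /\ (forall f, smooth (fun p => X p f)))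
          (X \in vf_pred).
Proof. exact: asboolP. Qed.

Lemma vf_tangent (X : vectorField) p : tangent p (X p).
Proof. by have /vfP[] := vf_subproof X. Qed.

Lemma vf_smooth (X : vectorField) f : (fun p => X p f) \in @smooth_pred _ _ M.
Proof. by have /vfP[_ +] := vf_subproof X => /(_ f) ?; apply/smoothP. Qed.

(* the smooth function [X f] *)
Definition vf_app (X : vectorField) (f : Coo) : Coo :=
  SmoothFun (vf_smooth X f).

Lemma vf_inj (X Y : vectorField) : (forall p f, X p f = Y p f) -> X = Y.
Proof.
by move=> XY; apply: val_inj; apply: funext => p; apply: funext => f; exact: XY.
Qed.

Lemma vf_zmod_closed : zmod_closed vf_pred.
Proof.
split=> [|X Y /vfP[tX sX] /vfP[tY sY]]; apply/vfP; split.
- by move=> p; split=> [f g|a f|f g]; rewrite /= ?addr0 ?mulr0 ?mul0r ?addr0.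
- by move=> f; exact: smooth_cst.
- move=> p; have [XD XZ XM] := tX p; have [YD YZ YM] := tY p.
  have E f : (X - Y) p f = X p f - Y p f by [].
  split=> [f g|a f|f g]; rewrite !E.
  + by rewrite XD YD opprD addrACA.
  + by rewrite XZ YZ mulrBr.
  + by rewrite XM YM opprD addrACA mulrBl mulrBr.
- by move=> f; apply: smoothD; [exact: sX|apply: smoothN; exact: sY].
Qed.

HB.instance Definition _ :=
  GRing.SubChoice_isSubZmodule.Build _ _ vectorField vf_zmod_closed.

Lemma vf_scale_subproof (h : Coo) (X : vectorField) :
  (fun p f => h p * X p f) \in vf_pred.
Proof.
apply/vfP; split=> [p|f]; last first.
  by apply: smoothM; apply/smoothP; [exact: smoothFun_subproof|exact: vf_smooth].
have [XD XZ XM] := vf_tangent X p; split=> [f g|a f|f g].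
- by rewrite XD mulrDr.
- by rewrite XZ mulrCA.
- by rewrite XM mulrDr !mulrA (mulrC (h p) (f p)).
Qed.

Definition vf_scale (h : Coo) (X : vectorField) : vectorField :=
  VectorField (vf_scale_subproof h X).

Lemma vf_scaleA (h k : Coo) (X : vectorField) :
  vf_scale h (vf_scale k X) = vf_scale (h * k) X.
Proof. by apply: vf_inj => p f; rewrite /= mulrA. Qed.

Lemma vf_scale1 : left_id (1 : Coo) vf_scale.
Proof. by move=> X; apply: vf_inj => p f; rewrite /= mul1r. Qed.

Lemma vf_scaleDr : right_distributive vf_scale +%R.
Proof. by move=> h X Y; apply: vf_inj => p f; rewrite /= mulrDr. Qed.

Lemma vf_scaleDl (X : vectorField) : {morph vf_scale^~ X : h k / h + k}.
Proof. by move=> h k; apply: vf_inj => p f; rewrite /= mulrDl. Qed.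

HB.instance Definition _ := GRing.Zmodule_isLmodule.Build Coo vectorField
  vf_scaleA vf_scale1 vf_scaleDr vf_scaleDl.

Lemma vf_appD (X : vectorField) : {morph vf_app X : f g / f + g}.
Proof.
by move=> f g; apply: smoothFun_inj => p; have [+ _ _] := vf_tangent X p; exact.
Qed.

Lemma vf_appZ (X : vectorField) (a : R) (f : Coo) :
  vf_app X (smooth_const M a * f) = smooth_const M a * vf_app X f.
Proof.
by apply: smoothFun_inj => p; have [_ + _] := vf_tangent X p; exact.
Qed.

Lemma vf_appM (X : vectorField) (f g : Coo) :
  vf_app X (f * g) = vf_app X f * g + f * vf_app X g.
Proof.
by apply: smoothFun_inj => p; have [_ _ +] := vf_tangent X p; exact.
Qed.

Lemma vf_bracket_subproof (X Y : vectorField) :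
  (fun p f => X p (vf_app Y f) - Y p (vf_app X f)) \in vf_pred.
Proof.
apply/vfP; split=> [p|f]; last first.
  apply: smoothD; last apply: smoothN; apply/smoothP; exact: vf_smooth.
have [XD XZ XM] := vf_tangent X p; have [YD YZ YM] := vf_tangent Y p.
split=> [f g|a f|f g].
- by rewrite !vf_appD XD YD opprD addrACA.
- by rewrite !vf_appZ XZ YZ mulrBr.
rewrite !vf_appM XD YD !XM !YM /=.
by ring.
Qed.

(* the Lie bracket [X, Y] *)
Definition vf_bracket (X Y : vectorField) : vectorField :=
  VectorField (vf_bracket_subproof X Y).

End vector_fields.

Section tensors.
Variables (R : realType) (n : nat) (M : smoothManifold R n).
Local Notation Coo := (smoothFun M).
Local Notation VF := (vectorField M).

(* Tensor fields are multilinear maps over the ring of smooth functions: those of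
   type (1,1) form the type [{linear VF -> VF}]. *)
Definition is_tensor12 (A : VF -> VF -> VF) : Prop :=
  (forall Y, linear (A^~ Y)) /\ (forall X, linear (A X)).

Record riemannianMetric := RiemannianMetric {
  rmetric :> VF -> VF -> Coo;
  rmetric_linearl : forall Y, scalar (rmetric^~ Y);
  rmetric_linearr : forall X, scalar (rmetric X);
  rmetric_sym : forall X Y, rmetric X Y = rmetric Y X;
  rmetric_pos : forall (X : VF) (p : M), X p <> 0 -> 0 < rmetric X X p }.

Definition is_connection (D : VF -> VF -> VF) : Prop :=
  [/\ forall Y, linear (D^~ Y),
      forall X Y Z : VF, D X (Y + Z) = D X Y + D X Z &
      forall (X : VF) (f : Coo) (Y : VF), D X (f *: Y) = vf_app X f *: Y + f *: D X Y].

Definition is_levi_civita (g : riemannianMetric) (D : VF -> VF -> VF) : Prop :=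
  [/\ is_connection D,
      forall X Y, D X Y - D Y X = vf_bracket X Y &
      forall X Y Z, vf_app X (g Y Z) = g (D X Y) Z + g Y (D X Z)].

(* [(D_X J) Y] *)
Definition cov_deriv (D : VF -> VF -> VF) (J : VF -> VF) (X Y : VF) : VF :=
  D X (J Y) - J (D X Y).

Definition formal_frobenius (g : riemannianMetric) (A : VF -> VF -> VF) : Prop :=
  [/\ is_tensor12 A,
      forall X Y Z, g (A X Y) Z = g X (A Y Z) &
      forall X Y, A X Y = A Y X].

End tensors.

(* Main.v *)
(** Differentiating [g (J Y) Z = g Y (J Z)] along [X] with the metric
    connection shows that each [nabla_X J] is again [g]-selfadjoint.  The
    Codazzi symmetry then moves the slots around:
    [g (A X Y) Z = g (A Y X) Z = g X (A Y Z)]. *)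
Require Import Defs.
From mathcomp Require Import all_boot all_order all_algebra.
From mathcomp Require Import all_classical all_reals all_analysis.

Import GRing.Theory.
Local Open Scope ring_scope.

Section cov_deriv_theory.
Variables (R : realType) (n : nat) (M : smoothManifold R n).
Local Notation VF := (vectorField M).

Lemma rmetricBl (g : riemannianMetric M) (X Y Z : VF) :
  g (X - Y) Z = g X Z - g Y Z.
Proof. by rewrite addrC -scaleN1r rmetric_linearl /= mulN1r addrC. Qed.

Lemma rmetricBr (g : riemannianMetric M) (X Y Z : VF) :
  g X (Y - Z) = g X Y - g X Z.
Proof. by rewrite ![g X _]rmetric_sym rmetricBl. Qed.

Lemma cov_deriv_linearl (D : VF -> VF -> VF) (J : {linear VF -> VF}) (Y : VF) :
  is_connection D -> linear (cov_deriv D J ^~ Y).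
Proof.
case=> Dl _ _ f X X'.
by rewrite /cov_deriv !Dl linearP scalerBr opprD addrACA.
Qed.

(** The connection alone is not function-linear in this slot, but the Leibniz term
    [vf_app X f *: J Y] arises both from [D X (J (f *: Y))] and from [J (D X (f *: Y))], as [J] is
    linear over smooth functions, so it cancels. *)
Lemma cov_deriv_linearr (D : VF -> VF -> VF) (J : {linear VF -> VF}) (X : VF) :
  is_connection D -> linear (cov_deriv D J X).
Proof.
case=> _ DD DZ f Y Y'; rewrite /cov_deriv linearP /= !DD !DZ -!addrA.
rewrite ![J (_ *: _ + _)]linearP /= scalerBr addrCA addrA [in LHS]addrA.
by rewrite [X in X - _]addrAC addrKA opprD addrACA.
Qed.

Lemma cov_deriv_selfadjoint (g : riemannianMetric M) (D : VF -> VF -> VF)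
    (J : VF -> VF) :
  (forall X Y Z, vf_app X (g Y Z) = g (D X Y) Z + g Y (D X Z)) ->
  (forall X Y, g (J X) Y = g X (J Y)) ->
  forall X Y Z, g (cov_deriv D J X Y) Z = g Y (cov_deriv D J X Z).
Proof.
(* Selfadjointness moves [J] off [D X Y] and [D X Z] onto the undifferentiated fields. *)
move=> Dg Jsa X Y Z; rewrite /cov_deriv rmetricBl rmetricBr Jsa -(Jsa Y).
(* With the negative terms transposed, each side is a Leibniz expansion: of [g (J Y) Z] and of
   [g Y (J Z)] along [X]. *)
apply/eqP; rewrite subr_eq addrAC eq_sym subr_eq eq_sym addrC [X in _ == X]addrC.
have := congr1 (vf_app X) (Jsa Y Z); rewrite !Dg => ->.
by rewrite addrC.
Qed.

End cov_deriv_theory.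

Theorem proposition4p1 (R : realType) (n : nat) (M : smoothManifold R n)
    (g : riemannianMetric M)
    (nabla : vectorField M -> vectorField M -> vectorField M)
    (nabla_LC : is_levi_civita g nabla)
    (J : {linear vectorField M -> vectorField M})
    (J_selfadj : forall X Y : vectorField M, g (J X) Y = g X (J Y))
    (J_codazzi : forall X Y : vectorField M,
       cov_deriv nabla J X Y = cov_deriv nabla J Y X) :
  formal_frobenius g (fun X Y => cov_deriv nabla J X Y).
Proof.
have [conn _ Dg] := nabla_LC; split=> [|X Y Z|//].
  by split=> [Y|X]; [exact: cov_deriv_linearl|exact: cov_deriv_linearr].
by rewrite J_codazzi; exact: cov_deriv_selfadjoint.
Qed.
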